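(* If $G$ is a connected proper circular-arc graph with non-bipartite complement, then the closed neighborhood hypergraph $\mathcal{N}[G]$ is strictly connected.
   Context: $\mathcal{N}[G]$ is the hypergraph on $V=V(G)$ with hyperedges $N[v]$ (closed neighborhoods), $v\in V$. A PCA graph is one having a representation by arcs of a circle, adjacency meaning intersection, in which no arc is contained in another. Nonempty sets $A,B\subseteq V$ strictly intersect if $A\subseteq B$, or $B\subseteq A$, or ($A\cap B\neq\emptyset$, neither contains the other, and $A\cup B\neq V$). A hypergraph is strictly connected if every vertex lies in a hyperedge and the graph on the hyperedges with adjacency meaning strict intersection is connected. *)

(* Defs.v *)
From mathcomp Require Import all_boot all_order all_algebra.
From mathcomp Require Import classical_sets reals trigo.

Set Implicit Arguments.
Unset Strict Implicit.
Unset Printing Implicit Defensive.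

(** Finite simple graphs are symmetric irreflexive relations on a [finType]. *)

Definition graph_connected (T : finType) (e : rel T) : Prop :=
  forall x y : T, connect e x y.

Definition graph_compl (T : finType) (e : rel T) : rel T :=
  [rel x y | (x != y) && ~~ e x y].

Definition bipartite (T : finType) (e : rel T) : Prop :=
  exists c : T -> bool, forall x y : T, e x y -> c x != c y.

Section CircularArcs.
Local Open Scope ring_scope.
Local Open Scope classical_set_scope.

(** The closed arc of the unit circle traversed counterclockwise from angle [a]
    to angle [b]; it is the whole circle when [b - a >= 2 * pi]. *)
Definition circle_arc (R : realType) (a b : R) : set (R * R) :=
  [set p | exists2 t : R, a <= t <= b & p = (cos t, sin t)].

(** Vertex [v] is represented by the arc from [l v] to [r v]. Since "no arc is
    contained in another" ranges over pairs of distinct vertices, the arcs are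
    in particular pairwise different. *)
Definition pca_graph (R : realType) (T : finType) (e : rel T) : Prop :=
  exists l r : T -> R,
    [/\ forall v, l v <= r v,
        forall u v, u != v ->
          (e u v <->
           circle_arc (l u) (r u) `&` circle_arc (l v) (r v) !=set0)
      & forall u v, u != v ->
          ~ (circle_arc (l u) (r u) `<=` circle_arc (l v) (r v))].
End CircularArcs.

Section Hypergraphs.
Local Open Scope set_scope.

(** A hypergraph on [T] is given by its set of hyperedges [H : {set {set T}}]. *)

Definition closed_nbhd (T : finType) (e : rel T) (v : T) : {set T} :=
  [set u : T | (u == v) || e v u].

Definition nbhd_hypergraph (T : finType) (e : rel T) : {set {set T}} :=
  [set closed_nbhd e v | v : T].

Definition strictly_intersect (T : finType) (A B : {set T}) : bool :=
  [&& A != finset.set0, B != finset.set0 &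
      [|| A \subset B, B \subset A |
          [&& A :&: B != finset.set0, ~~ (A \subset B), ~~ (B \subset A)
            & A :|: B != [set: T]]]].

Definition strictly_connected (T : finType) (H : {set {set T}}) : Prop :=
  (forall v : T, exists2 A : {set T}, A \in H & v \in A) /\
  graph_connected
    [rel A B : {A : {set T} | A \in H}
       | (A != B) && strictly_intersect (val A) (val B)].
End Hypergraphs.

(* Main.v *)
Require Import Defs.
From mathcomp Require Import all_boot all_order all_algebra.
From mathcomp Require Import boolp classical_sets reals trigo.
From mathcomp Require Import lra.

Set Implicit Arguments.
Unset Strict Implicit.
Unset Printing Implicit Defensive.

Import Order.TTheory GRing.Theory Num.Theory.

(** Lift the arcs to intervals of the universal cover of the circle. Properness
    says that the right ends of the lifts are ordered like their left ends.
    Suppose the arc of [u] contains the left end of the arc of [v], and no left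
    end lies strictly between those of [u] and [v]. If [N[u]] and [N[v]] covered
    all vertices, every arc would contain the left end of [u] or the right end
    of [v], so two cliques would cover the graph and its complement would be
    bipartite. Hence [N[u]] and [N[v]] strictly intersect. An arbitrary edge is
    subdivided by the left ends between those of its two arcs, which reduces it
    to such consecutive pairs, and connectedness of the graph concludes. *)

Lemma strictly_intersect_sym (T : finType) : symmetric (@strictly_intersect T).
Proof.
move=> A B; rewrite /strictly_intersect finset.setIC finset.setUC.
by do !case: (_ != _) => //=; case: (A \subset B); case: (B \subset A).
Qed.

Lemma strictly_intersectW (T : finType) (A B : {set T}) (x : T) :
  x \in A -> x \in B -> A :|: B != [set: T] -> strictly_intersect A B.
Proof.
move=> xA xB AB; rewrite /strictly_intersect AB andbT.
have -> : A != finset.set0 by apply/set0Pn; exists x.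
have -> : B != finset.set0 by apply/set0Pn; exists x.
have -> : A :&: B != finset.set0 by apply/set0Pn; exists x; rewrite inE xA xB.
by case: (A \subset B); case: (B \subset A).
Qed.

Lemma bipartite_compl_cliques (T : finType) (e : rel T) (A B : T -> Prop) :
  (forall x, A x \/ B x) ->
  (forall x y, x != y -> A x -> A y -> e x y) ->
  (forall x y, x != y -> B x -> B y -> e x y) ->
  bipartite (graph_compl e).
Proof.
move=> AB cA cB; exists (fun x => `[< A x >]) => x y /= /andP[xy].
apply: contraNneq; case: (asboolP (A x)) => [Ax /esym/asboolP Ay|nAx].
  exact: cA.
by move=> /esym/asboolPn nAy; apply: cB => //; [case: (AB x)|case: (AB y)].
Qed.

(** * Combinatorics of arcs lifted to the line *)

Section LiftedArcs.
Local Open Scope ring_scope.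
Variables (R : realFieldType) (T : finType) (K : Type) (e : rel T).
(** [K] indexes the lifts of an arc, one per whole turn; it is later instantiated with [int]. *)
Variables lo hi : T -> K -> R.
Hypothesis e_sym : symmetric e.
Hypothesis lo_le_hi : forall u j, lo u j <= hi u j.
Hypothesis adjP : forall u v j, u != v ->
  (e u v <-> exists k p, lo u j <= p <= hi u j /\ lo v k <= p <= hi v k).
Hypothesis hi_mono : forall u j v k, lo u j <= lo v k -> hi u j <= hi v k.
(** Period-free form of the fact that an arc is shorter than a full turn; it makes the measure in
    [edge_linked] decrease. *)
Hypothesis hi_short : forall u j w m m',
  lo u j <= lo w m -> lo w m < lo w m' -> hi u j < lo w m'.
Hypothesis e_cobip : ~ bipartite (graph_compl e).

Let nbhd_in u : closed_nbhd e u \in nbhd_hypergraph e.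
Proof. exact: imset_f. Qed.

Let N u : {A : {set T} | A \in nbhd_hypergraph e} :=
  exist (fun A : {set T} => A \in nbhd_hypergraph e) _ (nbhd_in u).

Let linked : rel {A : {set T} | A \in nbhd_hypergraph e} :=
  [rel A B | (A != B) && strictly_intersect (val A) (val B)].

Let linked_sym : symmetric linked.
Proof. by move=> A B; rewrite /linked /= eq_sym strictly_intersect_sym. Qed.

Let in_nbhd_lift u j x : x \in closed_nbhd e u ->
  exists m p, lo u j <= p <= hi u j /\ lo x m <= p <= hi x m.
Proof.
rewrite inE => /orP[/eqP ->|ux].
  by exists j, (lo u j); rewrite lexx lo_le_hi.
have [<-|uDx] := eqVneq u x; last exact/(adjP j uDx).
by exists j, (lo u j); rewrite lexx lo_le_hi.
Qed.

Lemma consecutive_nbhd_neqT u j v k :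
  lo u j <= lo v k <= hi u j ->
  (forall w m, ~ (lo u j < lo w m < lo v k)) ->
  closed_nbhd e u :|: closed_nbhd e v != [set: T].
Proof.
move=> /andP[uv vu] cons; apply/negP => /eqP cover; apply: e_cobip.
have huv := hi_mono uv.
apply: (@bipartite_compl_cliques _ _
          (fun x => exists m, lo x m <= lo u j <= hi x m)
          (fun x => exists m, lo x m <= hi v k <= hi x m)); first last.
- by move=> x y xy [m xm] [n yn]; apply/(adjP m xy); exists n, (hi v k).
- by move=> x y xy [m xm] [n yn]; apply/(adjP m xy); exists n, (lo u j).
(* If the arc of [x] starts no later than [lo u j], it contains that point since it reaches [p].
   Otherwise it starts no earlier than [lo v k], so by monotonicity it reaches [hi v k], and
   [p <= hi u j <= hi v k] puts that point inside. *)
have via_u x m p : lo u j <= p <= hi u j -> lo x m <= p <= hi x m ->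
    lo x m <= lo u j <= hi x m \/ lo x m <= hi v k <= hi x m.
  move=> pu px; case: (leP (lo x m) (lo u j)) => ux; first by left; lra.
  right; have vx : lo v k <= lo x m.
    by rewrite leNgt; apply/negP => xv; apply: (cons x m); rewrite ux xv.
  by have := hi_mono vx; lra.
have via_v x m p : lo v k <= p <= hi v k -> lo x m <= p <= hi x m ->
    lo x m <= lo u j <= hi x m \/ lo x m <= hi v k <= hi x m.
  move=> pv px; case: (leP (lo v k) (lo x m)) => vx.
    by right; have := hi_mono vx; lra.
  left; have xu : lo x m <= lo u j.
    by rewrite leNgt; apply/negP => ux; apply: (cons x m); rewrite ux vx.
  lra.
move=> x; have: x \in [set: T] by [].
rewrite -cover finset.in_setU => /orP[] xN.
  have [m [p [pu px]]] := in_nbhd_lift j xN.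
  by case: (via_u x m p pu px) => ?; [left|right]; exists m.
have [m [p [pv px]]] := in_nbhd_lift k xN.
by case: (via_v x m p pv px) => ?; [left|right]; exists m.
Qed.

(** Induction on the number of vertices with a lift starting strictly between the two left ends.
    Counting vertices rather than lifts keeps the measure finite for arbitrary [K]. *)
Lemma edge_linked u j v k :
  lo u j <= lo v k <= hi u j -> connect linked (N u) (N v).
Proof.
pose S u j v k := [set w : T | `[< exists m, lo u j < lo w m < lo v k >]].
have [n] := ubnP #|S u j v k|; elim: n => // n IHn in u j v k *.
rewrite ltnS => Sn uv.
have uN : u \in closed_nbhd e u by rewrite inE eqxx.
have uNv : u \in closed_nbhd e v.
  rewrite inE; have [//|uDv /=] := eqVneq u v.
  rewrite e_sym; apply/(adjP j uDv); exists k, (lo v k).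
  by rewrite uv lexx lo_le_hi.
have [[w [m uwv]]|none] := pselect (exists w m, lo u j < lo w m < lo v k).
  have wS : w \in S u j v k by rewrite finset.in_set; apply/asboolP; exists m.
  (* The arc of [w] thus still reaches [lo v k], so both halves fall under the induction
     hypothesis. *)
  have huw : hi u j <= hi w m by apply: hi_mono; lra.
  apply: (connect_trans (y := N w)).
  - apply: (IHn u j w m); last by lra.
    apply: leq_trans Sn; apply: proper_card; apply/properP; split.
      apply/fintype.subsetP => x; rewrite !finset.in_set => /asboolP[i xi].
      by apply/asboolP; exists i; lra.
    (* With two lifts of [w] starting between [lo u j] and [lo v k], [hi_short] would end the arc of
       [u] before the later one, against [lo v k <= hi u j]. So [w] leaves the set, here and in the
       other half. *)
    exists w => //; rewrite finset.in_set; apply/asboolPn => -[i wi].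
    have : hi u j < lo w m by apply: (@hi_short _ _ _ i); lra.
    lra.
  - apply: (IHn w m v k); last by lra.
    apply: leq_trans Sn; apply: proper_card; apply/properP; split.
      apply/fintype.subsetP => x; rewrite !finset.in_set => /asboolP[i xi].
      by apply/asboolP; exists i; lra.
    exists w => //; rewrite finset.in_set; apply/asboolPn => -[i wi].
    have : hi u j < lo w i by apply: (@hi_short _ _ _ m); lra.
    lra.
(* Twins share one hyperedge, while [linked] relates only distinct ones. *)
have [->|NuNv] := eqVneq (N u) (N v); first exact: connect0.
apply: connect1; rewrite /linked /= NuNv /=.
apply: strictly_intersectW uN uNv _; apply: (consecutive_nbhd_neqT uv).
by move=> w m uwv; apply: none; exists w, m.
Qed.

Lemma lifted_strictly_connected (j : K) :
  graph_connected e -> strictly_connected (nbhd_hypergraph e).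
Proof.
move=> e_conn; split.
  by move=> v; exists (closed_nbhd e v); rewrite ?inE ?eqxx //; exact: imset_f.
have edge u v : e u v -> connect linked (N u) (N v).
  move=> uv; have [->|uDv] := eqVneq u v; first exact: connect0.
  have [k [p [pu pv]]] := (adjP j uDv).1 uv.
  (* Of two meeting lifts, the one starting later has its left end in the other. *)
  have [luv|lvu] := leP (lo u j) (lo v k).
    by apply: (@edge_linked u j v k); lra.
  by rewrite (sym_connect_sym linked_sym); apply: (@edge_linked v k u j); lra.
have paths u v : connect linked (N u) (N v).
  have /connectP[p] := e_conn u v.
  elim: p u => [|w p IHp] u /=; first by move=> _ ->; exact: connect0.
  by move=> /andP[/edge uw wp] vp; apply: connect_trans uw (IHp _ wp vp).
move=> [A AH] [B BH].
have [u _ Au] := imsetP AH; have [v _ Bv] := imsetP BH.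
have -> : exist _ A AH = N u by exact: val_inj.
have -> : exist _ B BH = N v by exact: val_inj.
exact: paths.
Qed.

End LiftedArcs.

(** * Angles modulo a full turn and arcs of the circle *)

Section CircleArcs.
Local Open Scope ring_scope.
Local Open Scope classical_set_scope.
Variable R : realType.
Implicit Types (a b c d s t : R) (k : int).

Local Notation tau := (@pi R *+ 2).

Lemma floor_angle t : exists2 k, 0 <= t + k%:~R * tau & t + k%:~R * tau < tau.
Proof.
have tau_gt0 : 0 < tau by rewrite mulrn_wgt0 ?pi_gt0.
have /andP[fl fu] := floor_itv (t / tau).
move: fl; rewrite ler_pdivlMr // => fl.
move: fu; rewrite ltr_pdivrMr // intrD => fu.
exists (- Num.floor (t / tau)); rewrite intrN; lra.
Qed.

Lemma circle_shift t k :
  (cos (t + k%:~R * tau), sin (t + k%:~R * tau)) = (cos t, sin t).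
Proof.
have shiftn s n : (cos (s + tau *+ n), sin (s + tau *+ n)) = (cos s, sin s).
  by rewrite (periodicn (@cosD2pi R)) (periodicn (@sinD2pi R)).
case: k => n; first by rewrite -pmulrn mulr_natl shiftn.
by rewrite NegzE intrN mulNr -pmulrn mulr_natl
  -[in RHS](subrK (tau *+ n.+1) t) shiftn.
Qed.

(** The difference of the angles, reduced to [d] in [[0, tau)], has cosine 1. If [d > 0], then
    [sin (d / 2) > 0], and the double-angle formula forces [cos d < 1]. *)
Lemma circle_eq s t : (cos s, sin s) = (cos t, sin t) ->
  exists k, t = s + k%:~R * tau.
Proof.
move=> [cst sst]; have [k d0 dtau] := floor_angle (s - t).
set d := s - t + _ in d0 dtau.
have cd : cos d = 1.
  have [-> _] := circle_shift (s - t) k.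
  by rewrite cosB cst sst -!expr2 cos2Dsin2.
suff d_eq0 : d = 0 by exists k; rewrite /d in d_eq0; lra.
apply: contra_eq cd; rewrite neq_lt ltNge d0 /= => d_gt0.
have : 0 < sin (d / 2) by apply: sin_gt0_pi; lra.
have := cos2Dsin2 (d / 2).
have -> : cos d = cos (d / 2) ^+ 2 *+ 2 - 1.
  by rewrite -cos_mulr2n; congr cos; lra.
move=> cs s_gt0; rewrite lt_eqF //.
have : 0 < sin (d / 2) ^+ 2 by rewrite exprn_gt0.
lra.
Qed.

(** The turn [k] can be prescribed because a common point may be moved by whole turns; [adjP] needs
    this form. *)
Lemma circle_arc_meetP a b c d k :
  circle_arc a b `&` circle_arc c d !=set0 <->
  exists k' p, a + k%:~R * tau <= p <= b + k%:~R * tau /\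
               c + k'%:~R * tau <= p <= d + k'%:~R * tau.
Proof.
split.
- move=> [q [[s sab ->] [t tcd /circle_eq [i ti]]]].
  exists (k - i), (s + k%:~R * tau); rewrite intrB mulrBl; lra.
- move=> [i [p [pab pcd]]]; exists (cos p, sin p); split.
  + exists (p + (- k)%:~R * tau); last by rewrite circle_shift.
    by rewrite intrN; lra.
  + exists (p + (- i)%:~R * tau); last by rewrite circle_shift.
    by rewrite intrN; lra.
Qed.

(** Contraposed, this turns properness into the monotonicity [hi_mono]. *)
Lemma circle_arc_sub a b c d j k :
  c + k%:~R * tau <= a + j%:~R * tau -> b + j%:~R * tau <= d + k%:~R * tau ->
  circle_arc a b `<=` circle_arc c d.
Proof.
move=> ca bd q [t tab ->]; exists (t + (j - k)%:~R * tau).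
  by rewrite intrB; lra.
by rewrite circle_shift.
Qed.

Lemma circle_arc_full a b c d :
  a + tau <= b -> circle_arc c d `<=` circle_arc a b.
Proof.
move=> ab q [t _ ->]; have [k k0 k1] := floor_angle (t - a).
exists (t + k%:~R * tau); [lra | by rewrite circle_shift].
Qed.

End CircleArcs.

Theorem theorem3p6 (R : realType) (T : finType) (e : rel T)
    (e_sym : symmetric e) (e_irr : irreflexive e)
    (e_conn : graph_connected e) (e_pca : pca_graph R e)
    (e_cobip : ~ bipartite (graph_compl e)) :
  strictly_connected (nbhd_hypergraph e).
Proof.
have [l [r [lr adj proper]]] := e_pca.
pose tau : R := (pi *+ 2)%R.
have tau_gt0 : (0 < tau)%R by rewrite mulrn_wgt0 ?pi_gt0.
(* On a single vertex the complement has no edges and is bipartite. A second vertex is what rules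
   out an arc covering the circle, as that arc would contain the other one. *)
have other (u : T) : exists v : T, v != u.
  apply: contrapT => none; apply: e_cobip; exists xpredT => x y /= /andP[xy _].
  have all_u z : z = u by apply: contrapT => /eqP zu; apply: none; exists z.
  by rewrite (all_u x) (all_u y) eqxx in xy.
have short u : (r u < l u + tau)%R.
  rewrite ltNge; apply/negP => /circle_arc_full full.
  have [v vu] := other u; exact: proper vu (full _ _).
pose lo u (k : int) := (l u + k%:~R * tau)%R.
pose hi u (k : int) := (r u + k%:~R * tau)%R.
apply: (@lifted_strictly_connected R T int e lo hi) => //; last exact: 0%R.
- by move=> u j; rewrite lerD2r.
- move=> u v j uv; apply: iff_trans (adj u v uv) _.
  exact: circle_arc_meetP.
- move=> u j v k; rewrite /lo /hi; have [<-|uv] := eqVneq u v.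
    by rewrite !lerD2l.
  move=> luv; rewrite leNgt; apply/negP => hvu.
  rewrite eq_sym in uv.
  exact: proper uv (circle_arc_sub luv (ltW hvu)).
- move=> u j w m m'; rewrite /lo /hi => luw; rewrite ltrD2l ltr_pM2r //.
  (* Turns are integers, so [m < m'] gives [m + 1 <= m']: the two left ends are at least [tau]
     apart, more than the length of the arc of [u]. *)
  rewrite ltr_int -lezD1 -(@ler_int R) intrD -(ler_pM2r tau_gt0) => mm'.
  by have := short u; rewrite mulrDl mul1r in mm'; lra.
Qed.
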